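(* For every $f(X)\in\mathrm{dom}(\widehat{\partial}_{X:B})$, $$|f(X)-E[f(X)]|_{2}\leq 2\,|X|_{2}\,\|\widehat{\partial}_{X:B}[f(X)]\|_{\pi}.$$ Equivalently, for every $f(X)\in B^{(1)}(X)$ (where $B^{(1)}(X)$ is regarded as a subalgebra of $C^*(B\langle X\rangle)$ via the map $\iota$), $$|f(X)-E[f(X)]|_{2}\leq 2\,|X|_{2}\,\|\widetilde{\partial}_{X:B}[f(X)]\|_{\pi}.$$ Here $\|\cdot\|_{\pi}$ is the projective tensor norm on $C^*(B\langle X\rangle)^{\widehat{\otimes}2}$.
   Context: Let $M$ be a von Neumann algebra with a faithful normal tracial state $\tau$, let $B\subset M$ be a unital von Neumann subalgebra, and let $E:M\to B$ be the unique $\tau$-preserving conditional expectation. Write $\|\cdot\|$ for the operator norm and $|a|_{2}=\tau(a^*a)^{1/2}$ for $a\in M$. Let $X=X^*\in M$ be algebraically free from $B$, i.e. the canonical homomorphism from the algebraic free product $B*\mathbb{C}\langle t\rangle$ ($t$ an indeterminate) to $M$ which is the identity on $B$ and sends $t$ to $X$ is injective. Let $B\langle X\rangle=\mathrm{span}\{b_{0}Xb_{1}X\cdots Xb_{n}: n\in\mathbb{N}, b_i\in B\}$ (including $n=0$, so $B\subset B\langle X\rangle$), and let $C^*(B\langle X\rangle)\subset M$ be its operator-norm closure. The free difference quotient $\partial_{X:B}:B\langle X\rangle\to B\langle X\rangle\otimes B\langle X\rangle$ (algebraic tensor product) is the unique derivation, for the bimodule structure $a\cdot(b\otimes c)\cdot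 d=ab\otimes cd$, with $\partial_{X:B}[X]=1\otimes 1$ and $\partial_{X:B}[b]=0$ for all $b\in B$. Let $C^*(B\langle X\rangle)^{\overline{\otimes}2}\subset M\overline{\otimes}M$ denote the operator-norm completed tensor product (norm $\|\cdot\|$ inherited from the von Neumann algebra tensor product $M\overline{\otimes}M$), and let $C^*(B\langle X\rangle)^{\widehat{\otimes}2}$ denote the Banach space projective tensor product, with norm $\|\cdot\|_{\pi}$. The natural map $C^*(B\langle X\rangle)^{\widehat{\otimes}2}\to C^*(B\langle X\rangle)^{\overline{\otimes}2}$ is injective (Haagerup). Standing assumption: $\partial_{X:B}$, as a densely defined operator from $(C^*(B\langle X\rangle),\|\cdot\|)$ to $(C^*(B\langle X\rangle)^{\overline{\otimes}2},\|\cdot\|)$ with domain $B\langle X\rangle$, is closable. Consequently $\partial_{X:B}$ is also closable as an operator from $(C^*(B\langle X\rangle),\|\cdot\|)$ to $(C^*(B\langle X\rangle)^{\widehat{\otimes}2},\|\cdot\|_{\pi})$; its closure is denoted $\widehat{\partial}_{X:B}$, with domain $\mathrm{dom}(\widehat{\partial}_{X:B})$. $B^{(1)}(X)$ is the completion of $B\langle X\rangle$ in the norm $\||p(X)\||_{(1)}=\|p(X)\|+\|\partial_{X:B}[p(X)]\|_{\pi}$. The map $\iota:B^{(1)}(X)\to C^*(B\langle X\rangle)$ is the continuous extension of the identity map of $B\langle X\rangle$, and $\widetilde{\partial}_{X:B}:B^{(1)}(X)\to C^*(B\langle X\rangle)^{\widehat{\otimes}2}$ is the continuous extension of $\partial_{X:B}$.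 The map $\iota$ is injective with range $\mathrm{dom}(\widehat{\partial}_{X:B})$, and $\widetilde{\partial}_{X:B}=\widehat{\partial}_{X:B}\circ\iota$; elements of $B^{(1)}(X)$ are identified with their images under $\iota$. *)

(* Defs.v *)
From HB Require Import structures.
From mathcomp Require Import all_boot all_order all_algebra.
From mathcomp Require Import complex.
From mathcomp Require Import all_classical all_reals all_analysis.

Set Implicit Arguments.
Unset Strict Implicit.
Unset Printing Implicit Defensive.

Import Order.TTheory GRing.Theory Num.Theory.
Import numFieldNormedType.Exports.
Local Open Scope classical_set_scope.
Local Open Scope ring_scope.

(* Norms of normed modules over R[i] take values in R[i]; [nrm] is the same
   norm read in R. *)
Definition nrm (R : realType) (V : normedModType R[i]) (x : V) : R :=
  complex.Re `|x|.

(* A Hilbert space is a complete normed module over R[i] together with an inner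
   product (linear in its first argument) that induces its norm. *)
Definition hilbert_product (R : realType) (H : completeNormedModType R[i])
    (dot : {dot H for Num.conj}) : Prop :=
  forall x : H, `|x| ^+ 2 = dot x x.

Definition bounded_linear (R : realType) (U V : normedModType R[i])
    (a : U -> V) : Prop :=
  linear a /\ exists k : R, forall x, nrm (a x) <= k * nrm x.

(* Junk (0) when [a] is unbounded; only used for bounded operators. *)
Definition opnorm (R : realType) (U V : normedModType R[i]) (a : U -> V) : R :=
  sup [set nrm (a x) | x in [set x : U | nrm x <= 1]].

Definition is_adjoint (R : realType) (H : completeNormedModType R[i])
    (dot : {dot H for Num.conj}) (a b : H -> H) : Prop :=
  forall x y, dot (a x) y = dot x (b y).

Definition adj (R : realType) (H : completeNormedModType R[i])
    (dot : {dot H for Num.conj}) (a : H -> H) : H -> H :=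
  xget 0 [set b | is_adjoint dot a b].

Definition positive_op (R : realType) (H : completeNormedModType R[i])
    (dot : {dot H for Num.conj}) (a : H -> H) : Prop :=
  forall x, 0 <= dot (a x) x.

(* Unital *-subalgebras of B(H) that are closed in the weak operator topology.
   The product of B(H) is composition. *)
Record von_neumann_algebra (R : realType) (H : completeNormedModType R[i])
    (dot : {dot H for Num.conj}) (M : set (H -> H)) : Prop := VonNeumannAlgebra {
  vn_bounded : forall a, M a -> bounded_linear a;
  vn_id : M idfun;
  vn_linear : forall (c : R[i]) a b, M a -> M b -> M (c *: a + b);
  vn_comp : forall a b, M a -> M b -> M (a \o b);
  vn_adjoint : forall a, M a -> exists2 b, M b & is_adjoint dot a b;
  vn_wot_closed : forall a, bounded_linear a ->
    (forall (s : seq (H * H)) (e : R), 0 < e ->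
       exists2 b, M b &
         forall xy, xy \in s ->
           complex.Re `|dot (a xy.1 - b xy.1) xy.2| < e) ->
    M a }.

(* Normality: [tau] preserves suprema of directed sets of self-adjoint elements
   of M that have a supremum in M.  The supremum property of [tau a] only asks
   for leastness; that it is an upper bound follows from positivity. *)
Record faithful_normal_tracial_state (R : realType)
    (H : completeNormedModType R[i]) (dot : {dot H for Num.conj})
    (M : set (H -> H)) (tau : (H -> H) -> R[i]) : Prop :=
  FaithfulNormalTracialState {
  state_linear : forall (c : R[i]) a b, M a -> M b ->
    tau (c *: a + b) = c * tau a + tau b;
  state_unital : tau idfun = 1;
  state_positive : forall a, M a -> positive_op dot a -> 0 <= tau a;
  state_faithful : forall a, M a -> positive_op dot a -> tau a = 0 -> a = 0;
  state_tracial : forall a b, M a -> M b -> tau (a \o b) = tau (b \o a);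
  state_normal : forall (D : set (H -> H)) (a : H -> H),
    D `<=` M -> (forall d, D d -> is_adjoint dot d d) -> D !=set0 ->
    (forall d1 d2, D d1 -> D d2 -> exists d, [/\ D d,
       positive_op dot (d - d1) & positive_op dot (d - d2)]) ->
    M a -> (forall d, D d -> positive_op dot (a - d)) ->
    (forall b, M b -> is_adjoint dot b b ->
       (forall d, D d -> positive_op dot (b - d)) -> positive_op dot (b - a)) ->
    forall t : R[i], (forall d, D d -> tau d <= t) -> tau a <= t }.

Record trace_cond_expectation (R : realType)
    (H : completeNormedModType R[i]) (dot : {dot H for Num.conj})
    (M B : set (H -> H)) (tau : (H -> H) -> R[i])
    (E : (H -> H) -> (H -> H)) : Prop := TraceCondExpectation {
  ce_range : forall a, M a -> B (E a);
  ce_linear : forall (c : R[i]) a b, M a -> M b ->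
    E (c *: a + b) = c *: E a + E b;
  ce_id : forall b, B b -> E b = b;
  ce_bimodule : forall b1 a b2, B b1 -> M a -> B b2 ->
    E (b1 \o a \o b2) = b1 \o E a \o b2;
  ce_positive : forall a, M a -> positive_op dot a -> positive_op dot (E a);
  ce_trace : forall a, M a -> tau (E a) = tau a }.

Definition l2norm (R : realType) (H : completeNormedModType R[i])
    (dot : {dot H for Num.conj}) (tau : (H -> H) -> R[i]) (a : H -> H) : R :=
  Num.sqrt (complex.Re (tau (adj dot a \o a))).

(* Elements of the free product B * C<t> are represented by formal sums of
   words b0 t b1 t ... t bn, a word being coded as (b0, [:: b1; ...; bn]);
   scalars are absorbed in b0. *)
Definition poly_in (T : eqType) (B : set T) (p : seq (T * seq T)) : Prop :=
  forall w, w \in p -> B w.1 /\ forall b, b \in w.2 -> B b.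

Definition word_at (T : Type) (X : T -> T) (w : (T -> T) * seq (T -> T)) :
    T -> T :=
  foldl (fun p b => p \o X \o b) w.1 w.2.

(* p(X) *)
Definition poly_at (R : realType) (H : completeNormedModType R[i])
    (X : H -> H) (p : seq ((H -> H) * seq (H -> H))) : H -> H :=
  \sum_(w <- p) word_at X w.

(* B<X> *)
Definition poly_alg (R : realType) (H : completeNormedModType R[i])
    (B : set (H -> H)) (X : H -> H) : set (H -> H) :=
  [set poly_at X p | p in [set p | poly_in B p]].

Record unital_hom_on (R : realType) (H : completeNormedModType R[i])
    (B : set (H -> H)) (D : algType R[i]) (phi : (H -> H) -> D) : Prop :=
  UnitalHomOn {
  uh_linear : forall (c : R[i]) a b, B a -> B b ->
    phi (c *: a + b) = c *: phi a + phi b;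
  uh_one : phi idfun = 1;
  uh_mul : forall a b, B a -> B b -> phi (a \o b) = phi a * phi b }.

Definition poly_image (R : realType) (H : completeNormedModType R[i])
    (D : algType R[i]) (phi : (H -> H) -> D) (d : D)
    (p : seq ((H -> H) * seq (H -> H))) : D :=
  \sum_(w <- p) foldl (fun q b => q * d * phi b) (phi w.1) w.2.

(* By the universal property of the free product of unital algebras, a formal
   sum is zero in B * C<t> iff it vanishes under every homomorphism given by a
   unital homomorphism phi of B and an arbitrary image d of t. *)
Definition free_product_zero (R : realType) (H : completeNormedModType R[i])
    (B : set (H -> H)) (p : seq ((H -> H) * seq (H -> H))) : Prop :=
  forall (D : algType R[i]) (phi : (H -> H) -> D) (d : D),
    unital_hom_on B phi -> poly_image phi d p = 0.

(* Injectivity of the canonical homomorphism B * C<t> -> M, t |-> X. *)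
Definition algebraically_free (R : realType) (H : completeNormedModType R[i])
    (B : set (H -> H)) (X : H -> H) : Prop :=
  forall p, poly_in B p -> poly_at X p = 0 -> free_product_zero B p.

(* Operator-norm closure in B(H). *)
Definition norm_closure (R : realType) (H : completeNormedModType R[i])
    (S : set (H -> H)) : set (H -> H) :=
  [set a | bounded_linear a /\
    forall e : R, 0 < e -> exists2 p, S p & opnorm (a - p) < e].

(* C^*(B<X>) *)
Definition cstar_poly_alg (R : realType) (H : completeNormedModType R[i])
    (B : set (H -> H)) (X : H -> H) : set (H -> H) :=
  norm_closure (poly_alg B X).

(* For a linear subspace S of B(H), elements of the algebraic tensor product
   S (x) S are represented by lists of elementary tensors (finite formal sums)
   with entries in S; [tensor_eq S] is equality in S (x) S, expressed through
   its universal property. *)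
Definition tensor_in (T : eqType) (S : set T) (u : seq (T * T)) : Prop :=
  forall t, t \in u -> S t.1 /\ S t.2.

Definition bilinear_on (R : realType) (H : completeNormedModType R[i])
    (S : set (H -> H)) (V : lmodType R[i])
    (f : (H -> H) -> (H -> H) -> V) : Prop :=
  (forall (c : R[i]) a a' b, S a -> S a' -> S b ->
     f (c *: a + a') b = c *: f a b + f a' b) /\
  (forall (c : R[i]) a b b', S a -> S b -> S b' ->
     f a (c *: b + b') = c *: f a b + f a b').

Definition tensor_eval (R : realType) (H : completeNormedModType R[i])
    (V : lmodType R[i]) (f : (H -> H) -> (H -> H) -> V)
    (u : seq ((H -> H) * (H -> H))) : V :=
  \sum_(t <- u) f t.1 t.2.

Definition tensor_eq (R : realType) (H : completeNormedModType R[i])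
    (S : set (H -> H)) (u v : seq ((H -> H) * (H -> H))) : Prop :=
  forall (V : lmodType R[i]) (f : (H -> H) -> (H -> H) -> V),
    bilinear_on S f -> tensor_eval f u = tensor_eval f v.

Definition tensor_scale (R : realType) (H : completeNormedModType R[i])
    (c : R[i]) (u : seq ((H -> H) * (H -> H))) : seq ((H -> H) * (H -> H)) :=
  [seq (c *: t.1, t.2) | t <- u].

(* The bimodule structure a . (b (x) c) . d = ab (x) cd. *)
Definition tensor_act (T : Type) (a : T -> T) (u : seq ((T -> T) * (T -> T)))
    (d : T -> T) : seq ((T -> T) * (T -> T)) :=
  [seq (a \o t.1, t.2 \o d) | t <- u].

(* The free difference quotient; sums of tensors are concatenations. *)
Record free_difference_quotient (R : realType)
    (H : completeNormedModType R[i]) (B : set (H -> H)) (X : H -> H)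
    (del : (H -> H) -> seq ((H -> H) * (H -> H))) : Prop :=
  FreeDifferenceQuotient {
  fdq_range : forall p, poly_alg B X p -> tensor_in (poly_alg B X) (del p);
  fdq_linear : forall (c : R[i]) p q, poly_alg B X p -> poly_alg B X q ->
    tensor_eq (poly_alg B X) (del (c *: p + q))
      (tensor_scale c (del p) ++ del q);
  fdq_leibniz : forall p q, poly_alg B X p -> poly_alg B X q ->
    tensor_eq (poly_alg B X) (del (p \o q))
      (tensor_act idfun (del p) q ++ tensor_act p (del q) idfun);
  fdq_X : tensor_eq (poly_alg B X) (del X) [:: (idfun, idfun)];
  fdq_B : forall b, B b -> tensor_eq (poly_alg B X) (del b) [::] }.

(* K is the Hilbert space tensor product of H with itself,
   [ten x y] being x (x) y. *)
Record hilbert_tensor (R : realType) (H K : completeNormedModType R[i])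
    (dotH : {dot H for Num.conj}) (dotK : {dot K for Num.conj})
    (ten : H -> H -> K) : Prop := HilbertTensor {
  ht_linearl : forall y, linear (ten^~ y);
  ht_linearr : forall x, linear (ten x);
  ht_dot : forall x y x' y',
    dotK (ten x y) (ten x' y') = dotH x x' * dotH y y';
  ht_dense : forall (z : K) (e : R), 0 < e -> exists s : seq (H * H),
    nrm (z - \sum_(xy <- s) ten xy.1 xy.2) < e }.

(* The algebraic tensor u = sum a_i (x) b_i, seen as the operator T on K
   with T (x (x) y) = sum a_i x (x) b_i y. *)
Definition acts_as (R : realType) (H K : completeNormedModType R[i])
    (ten : H -> H -> K) (u : seq ((H -> H) * (H -> H))) (T : K -> K) : Prop :=
  bounded_linear T /\
  forall x y, T (ten x y) = \sum_(t <- u) ten (t.1 x) (t.2 y).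

(* The completion of A (x) A in the operator norm of K.  The von Neumann
   algebra tensor product of M with itself is an operator algebra on K, so its
   norm is the operator norm of K. *)
Definition operator_tensor_square (R : realType)
    (H K : completeNormedModType R[i]) (ten : H -> H -> K)
    (A : set (H -> H)) : set (K -> K) :=
  norm_closure [set T | exists2 u, tensor_in A u & acts_as ten u T].

Definition closable_in_operator_norm (R : realType)
    (H K : completeNormedModType R[i]) (ten : H -> H -> K)
    (B : set (H -> H)) (X : H -> H)
    (del : (H -> H) -> seq ((H -> H) * (H -> H))) : Prop :=
  forall (p : nat -> H -> H) (T : nat -> K -> K) (S : K -> K),
    (forall n, poly_alg B X (p n)) ->
    (forall n, acts_as ten (del (p n)) (T n)) ->
    operator_tensor_square ten (cstar_poly_alg B X) S ->
    opnorm (p n) @[n --> \oo] --> (0 : R) ->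
    opnorm (T n - S) @[n --> \oo] --> (0 : R) ->
    S = 0.

(* The projective norm on the algebraic tensor product A (x) A. *)
Definition projective_norm (R : realType) (H : completeNormedModType R[i])
    (A : set (H -> H)) (u : seq ((H -> H) * (H -> H))) : R :=
  inf [set \sum_(t <- v) opnorm t.1 * opnorm t.2 |
       v in [set v | tensor_in A v /\ tensor_eq A v u]].

(* The Banach space P is the completion of A (x) A in the projective norm,
   [ten a b] being a (x) b. *)
Record projective_tensor (R : realType) (H : completeNormedModType R[i])
    (A : set (H -> H)) (P : completeNormedModType R[i])
    (ten : (H -> H) -> (H -> H) -> P) : Prop := ProjectiveTensor {
  pt_bilinear : bilinear_on A ten;
  pt_norm : forall u, tensor_in A u ->
    nrm (tensor_eval ten u) = projective_norm A u;
  pt_dense : forall (z : P) (e : R), 0 < e ->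
    exists2 u, tensor_in A u & nrm (z - tensor_eval ten u) < e }.

(* The graph of the closure of the free difference quotient, as an operator
   from C^*(B<X>) to its projective tensor square P: [closure_graph ... f z]
   says that f is in the domain and is mapped to z. *)
Definition closure_graph (R : realType) (H P : completeNormedModType R[i])
    (ten : (H -> H) -> (H -> H) -> P) (B : set (H -> H)) (X : H -> H)
    (del : (H -> H) -> seq ((H -> H) * (H -> H))) (f : H -> H) (z : P) : Prop :=
  cstar_poly_alg B X f /\
  exists p : nat -> H -> H,
    [/\ forall n, poly_alg B X (p n),
        opnorm (p n - f) @[n --> \oo] --> (0 : R) &
        nrm (tensor_eval ten (del (p n)) - z) @[n --> \oo] --> (0 : R)].

(* The Banach space N is the completion B^(1)(X) of B<X> in the norm
   ||p|| + ||del p||_pi, with canonical embedding [j]. *)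
Record B1_completion (R : realType) (H N : completeNormedModType R[i])
    (B : set (H -> H)) (X : H -> H)
    (del : (H -> H) -> seq ((H -> H) * (H -> H)))
    (j : (H -> H) -> N) : Prop := B1Completion {
  b1_linear : forall (c : R[i]) p q, poly_alg B X p -> poly_alg B X q ->
    j (c *: p + q) = c *: j p + j q;
  b1_norm : forall p, poly_alg B X p ->
    nrm (j p) = opnorm p + projective_norm (cstar_poly_alg B X) (del p);
  b1_dense : forall (f : N) (e : R), 0 < e ->
    exists2 p, poly_alg B X p & nrm (f - j p) < e }.

(* iota : B^(1)(X) -> C^*(B<X>) *)
Record B1_iota (R : realType) (H N : completeNormedModType R[i])
    (B : set (H -> H)) (X : H -> H) (j : (H -> H) -> N)
    (iota : N -> H -> H) : Prop := B1Iota {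
  iota_linear : linear iota;
  iota_range : forall f, cstar_poly_alg B X (iota f);
  iota_bounded : exists k : R, forall f, opnorm (iota f) <= k * nrm f;
  iota_extends : forall p, poly_alg B X p -> iota (j p) = p }.

(* The continuous extension of the free difference quotient to B^(1)(X). *)
Definition B1_derivation (R : realType) (H N P : completeNormedModType R[i])
    (ten : (H -> H) -> (H -> H) -> P) (B : set (H -> H)) (X : H -> H)
    (del : (H -> H) -> seq ((H -> H) * (H -> H))) (j : (H -> H) -> N)
    (delt : N -> P) : Prop :=
  bounded_linear delt /\
  forall p, poly_alg B X p -> delt (j p) = tensor_eval ten (del p).

(* Main.v *)
Require Import Defs.
From HB Require Import structures.
From mathcomp Require Import all_boot all_order all_algebra.
From mathcomp Require Import complex.
From mathcomp Require Import all_classical all_reals all_analysis.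
From mathcomp Require Import ring.

(** Put |a|_2 = tau(a^* a)^(1/2). In the M-M bimodule spanned by a vector xi
    that commutes with B and satisfies <a xi b, c xi d> = tau(d^* E(c^* a) b)
    (the Jones projection of B in the basic construction), p |-> p xi - xi p is
    a derivation of B<X> vanishing on B. By uniqueness of the free difference
    quotient, if the latter maps p to the sum of the a_i (x) b_i, then
      p xi - xi p = sum_i a_i (X xi - xi X) b_i.
    Pairing both sides with s^* xi for a fixed s in M gives a scalar identity
    in which neither the vector nor the bimodule appears any more:
      tau(s (p - E p)) = sum_i (tau(s a_i X E(b_i)) - tau(E(s a_i) X b_i)).
    It is proved by induction on words ([tensor_eval_commutator_pairing]), which
    spares the construction of the bimodule.

    Each of the two traces on the right is at most
    |s^*|_2 |X|_2 ||a_i|| ||b_i||: this uses the Cauchy-Schwarz inequality for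
    tau, the traciality of tau, and the contractivity of E for |.|_2 and for the
    operator norm ([commutator_pairing_le]). These two traces are the source of
    the factor 2. The right hand side is a bilinear expression in the tensor, so
    it may be evaluated on any representative of the tensor, and taking the
    infimum over representatives bounds it by the projective norm
    ([poincare_polynomial]):
      |tau(s (p - E p))| <= 2 |s^*|_2 |X|_2 ||del p||_pi.
    For fixed s the left hand side is continuous in p for the operator norm, so
    the estimate passes to an element f of the domain of the closure. Choosing
    s = (f - E f)^* then yields
    |f - E f|_2^2 <= 2 |f - E f|_2 |X|_2 ||del f||_pi
    ([poincare_of_approx]). *)

Set Implicit Arguments.
Unset Strict Implicit.
Unset Printing Implicit Defensive.

Import Order.TTheory GRing.Theory Num.Theory.
Import numFieldNormedType.Exports.
Local Open Scope classical_set_scope.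
Local Open Scope ring_scope.

(** * A scalar form of the Cauchy-Schwarz inequality *)

(** Common core of the Cauchy-Schwarz inequalities for the inner product of a
    Hilbert space and for (a, b) |-> tau(a^* b). The latter form lives on a
    subset of the operators, so the lemma mentions the numbers p = <x, x>,
    q = <x, y>, r = <y, y> only. *)
Lemma cauchy_schwarz_of_quadratic (C : numClosedFieldType) (p q r : C) :
  0 <= p -> 0 <= r ->
  (forall l : C, 0 <= p - l^* * q - l * q^* + l * l^* * r) ->
  `|q| ^+ 2 <= p * r.
Proof.
move=> p0; rewrite le_eqVlt => /predU1P[<-|r0] hl.
  have [->|q0] := eqVneq q 0; first by rewrite normr0 expr0n /= mulr0.
  have q20 : 0 < `|q| ^+ 2 by rewrite exprn_gt0// normr_gt0.
  (* When r = 0, going far enough along q would make the form negative. *)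
  pose t := (p + 1) / `|q| ^+ 2.
  have t0 : 0 <= t by rewrite divr_ge0 ?addr_ge0// ltW.
  have := hl (t * q); rewrite rmorphM /= (geC0_conj t0) mulr0 addr0.
  have -> : p - t * q^* * q - t * q * q^* = - (p + 2).
    have -> : t * q^* * q = p + 1.
      by rewrite -mulrA (mulrC q^*) -normCK divfK// gt_eqF.
    have -> : t * q * q^* = p + 1.
      by rewrite -mulrA -normCK divfK// gt_eqF.
    by ring.
  by rewrite oppr_ge0 lt_geF// ltr_wpDl.
have r0' := gt_eqF r0.
(* The minimum of the quadratic form is at l = q / r. *)
have := hl (q / r); rewrite rmorphM fmorphV /= (geC0_conj (ltW r0)).
have -> : p - q^* / r * q - q / r * q^* + q / r * (q^* / r) * r =
    p - q * q^* / r by field; rewrite r0'.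
by rewrite -normCK subr_ge0 ler_pdivrMr.
Qed.

(** * Operator norms *)

Section Norms.
Variables (R : realType).
Implicit Types (V : normedModType R[i]).

Lemma nrmE V (x : V) : `|x| = (nrm x)%:C%C.
Proof. by rewrite /nrm RRe_real// normr_real. Qed.

Lemma nrm_ge0 V (x : V) : 0 <= nrm x.
Proof. by rewrite -ler0c -nrmE. Qed.

Lemma nrmD V (x y : V) : nrm (x + y) <= nrm x + nrm y.
Proof. by rewrite -lecR rmorphD/= -!nrmE ler_normD. Qed.

Lemma nrmN V (x : V) : nrm (- x) = nrm x.
Proof. by rewrite /nrm normrN. Qed.

Lemma nrmB V (x y : V) : nrm (x - y) = nrm (y - x).
Proof. by rewrite /nrm distrC. Qed.

Lemma nrmZ V (k : R) (x : V) : 0 <= k -> nrm (k%:C%C *: x) = k * nrm x.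
Proof.
move=> k0; apply/complexI; rewrite rmorphM/= -!nrmE normrZ ger0_norm//.
by rewrite ler0c.
Qed.

Lemma nrm0 V : nrm (0 : V) = 0.
Proof. by rewrite /nrm normr0. Qed.

Lemma nrm_eq0 V (x : V) : nrm x = 0 -> x = 0.
Proof. by move=> x0; apply/eqP; rewrite -normr_eq0 nrmE x0. Qed.

Lemma bounded_linearB V (W : normedModType R[i]) (a b : V -> W) :
  bounded_linear a -> bounded_linear b -> bounded_linear (a - b).
Proof.
move=> [la [k hk]] [lb [l hl]]; split.
  move=> c x y; rewrite /GRing.add /GRing.opp /=.
  by rewrite la lb scalerBr opprD addrACA.
exists (k + l) => x; rewrite mulrDl (le_trans (nrmD _ _))// lerD//.
by rewrite nrmN.
Qed.

Lemma linear_fun0 V (W : normedModType R[i]) (a : V -> W) : linear a -> a 0 = 0.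
Proof.
move=> la; have := la 1 0 0; rewrite scaler0 scale1r addr0 => /eqP.
by rewrite -subr_eq0 opprD addrA subrr add0r oppr_eq0 => /eqP.
Qed.

Lemma nrm_le_opnorm V (W : normedModType R[i]) (a : V -> W) (x : V) :
  bounded_linear a -> nrm x <= 1 -> nrm (a x) <= opnorm a.
Proof.
move=> [la [k hk]] x1; apply: ub_le_sup; last by exists x.
exists `|k| => _ [z /= z1 <-]; apply: le_trans (hk z) _.
rewrite (le_trans (ler_norm _))// normrM ler_piMr// ger0_norm//.
exact: nrm_ge0.
Qed.

Lemma opnorm_ge0 V (W : normedModType R[i]) (a : V -> W) :
  bounded_linear a -> 0 <= opnorm a.
Proof.
move=> ba; apply: le_trans (nrm_le_opnorm (x := 0) ba _); first exact: nrm_ge0.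
by rewrite nrm0.
Qed.

Lemma opnorm_ub V (W : normedModType R[i]) (a : V -> W) (x : V) :
  bounded_linear a -> nrm (a x) <= opnorm a * nrm x.
Proof.
move=> ba; have la : linear a by case: ba.
have [x0|x0] := eqVneq (nrm x) 0.
  by rewrite (nrm_eq0 x0) (linear_fun0 la) !nrm0 mulr0.
have xp : 0 < nrm x by rewrite lt_def x0 nrm_ge0.
pose y := (nrm x)^-1%:C%C *: x.
have ay : a y = (nrm x)^-1%:C%C *: a x.
  by have := la (nrm x)^-1%:C%C x 0; rewrite (linear_fun0 la) !addr0.
have y1 : nrm y <= 1 by rewrite nrmZ ?invr_ge0 ?nrm_ge0// mulVf.
have := nrm_le_opnorm ba y1.
by rewrite ay nrmZ ?invr_ge0 ?nrm_ge0// mulrC ler_pdivrMr.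
Qed.

Lemma opnorm_le V (W : normedModType R[i]) (a : V -> W) (k : R) : 0 <= k ->
  (forall x, nrm (a x) <= k * nrm x) -> opnorm a <= k.
Proof.
move=> k0 ha; apply: ge_sup; first by exists (nrm (a 0)), 0 => //=; rewrite nrm0.
move=> _ [z /= z1 <-]; apply: le_trans (ha z) _; exact: ler_piMr.
Qed.

End Norms.

(** * Adjoints in a Hilbert space *)

Section Adjoints.
Variables (R : realType) (H : completeNormedModType R[i]).
Variables (dot : {dot H for Num.conj}).
Implicit Types (a b : H -> H).

Lemma dotC x y : dot x y = (dot y x)^*.
Proof. by rewrite hermC /= expr0 mul1r. Qed.

Lemma dotDl x y z : dot (x + y) z = dot x z + dot y z.
Proof. by rewrite linearDl. Qed.
Lemma dotZl c x z : dot (c *: x) z = c * dot x z.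
Proof. by rewrite linearZl_LR. Qed.
Lemma dotNl x z : dot (- x) z = - dot x z.
Proof. by rewrite linearNl. Qed.
Lemma dotDr x y z : dot z (x + y) = dot z x + dot z y.
Proof. by rewrite linearDr. Qed.
Lemma dotNr x z : dot z (- x) = - dot z x.
Proof. by rewrite linearNr. Qed.
Lemma dotZr c x z : dot z (c *: x) = c^* * dot z x.
Proof. by rewrite linearZr_LR. Qed.

Lemma dot_nondeg x : (forall y, dot y x = 0) -> x = 0.
Proof. by move=> h; apply/eqP; rewrite -(dnorm_eq0 dot) h. Qed.

Lemma is_adjoint_sym a b : is_adjoint dot a b -> is_adjoint dot b a.
Proof. by move=> h x y; rewrite dotC -h -dotC. Qed.

Lemma is_adjoint_inj a b c :
  is_adjoint dot a b -> is_adjoint dot a c -> b = c.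
Proof.
move=> hb hc; apply/funext => y; apply/eqP; rewrite -subr_eq0; apply/eqP.
by apply: dot_nondeg => x; rewrite dotDr dotNr -hb -hc subrr.
Qed.

Lemma adjE a b : is_adjoint dot a b -> adj dot a = b.
Proof.
move=> h; apply/(is_adjoint_inj _ h).
exact: (@xgetPex _ 0 [set b | is_adjoint dot a b] (ex_intro _ b h)).
Qed.

Lemma is_adjoint_comp a b a' b' : is_adjoint dot a a' -> is_adjoint dot b b' ->
  is_adjoint dot (a \o b) (b' \o a').
Proof. by move=> ha hb x y /=; rewrite ha hb. Qed.

Lemma is_adjoint_linear c a b a' b' :
  is_adjoint dot a a' -> is_adjoint dot b b' ->
  is_adjoint dot (c *: a + b) (c^* *: a' + b').
Proof.
move=> ha hb x y; rewrite /GRing.add /GRing.scale /=.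
by rewrite dotDl dotZl ha hb dotDr dotZr conjCK.
Qed.

Lemma is_adjointB a b a' b' :
  is_adjoint dot a a' -> is_adjoint dot b b' ->
  is_adjoint dot (a - b) (a' - b').
Proof.
move=> ha hb x y; rewrite /GRing.add /GRing.opp /=.
by rewrite dotDl dotNl ha hb dotDr dotNr.
Qed.

Hypothesis hH : hilbert_product dot.

Lemma dotE x : dot x x = (nrm x ^+ 2)%:C%C.
Proof. by rewrite -hH nrmE rmorphXn. Qed.

Lemma dot_le x y : `|dot x y| <= (nrm x * nrm y)%:C%C.
Proof.
rewrite -ler_sqr ?nnegrE ?normr_ge0//; last first.
  by rewrite ler0c mulr_ge0 ?nrm_ge0.
have -> : (nrm x * nrm y)%:C%C ^+ 2 = dot x x * dot y y.
  by rewrite !dotE -rmorphM -exprMn rmorphXn.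
apply: cauchy_schwarz_of_quadratic => [||l].
- exact: dnorm_ge0.
- exact: dnorm_ge0.
rewrite (_ : _ + _ = dot (x - l *: y) (x - l *: y)); first exact: dnorm_ge0.
rewrite !(dotDl, dotDr, dotNl, dotNr, dotZl, dotZr) -(dotC y x).
by ring.
Qed.

(** ||b y||^2 = <a (b y), y> <= ||a|| ||b y|| ||y||. *)
Lemma opnorm_adjoint a b : bounded_linear a -> bounded_linear b ->
  is_adjoint dot a b -> opnorm b <= opnorm a.
Proof.
move=> ha hb hab; apply: opnorm_le (opnorm_ge0 ha) _ => y.
have := opnorm_ub (b y) ha.
have [->|by0] := eqVneq (nrm (b y)) 0.
  by move=> _; rewrite mulr_ge0 ?nrm_ge0 ?opnorm_ge0.
have byp : 0 < nrm (b y) by rewrite lt_def by0 nrm_ge0.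
move=> h; rewrite -(ler_pM2r byp) -expr2.
have := dot_le (a (b y)) y; rewrite hab dotE ger0_norm ?ler0c ?sqr_ge0//.
rewrite lecR => /le_trans; apply.
by rewrite [leRHS]mulrAC ler_wpM2r// nrm_ge0.
Qed.

End Adjoints.
(** * Algebra in a von Neumann algebra *)

Section Algebra.
Variables (R : realType) (H : completeNormedModType R[i]).
Variables (dot : {dot H for Num.conj}) (M : set (H -> H)).
Hypothesis hM : von_neumann_algebra dot M.
Implicit Types (a b : H -> H).

Lemma vn_lin a : M a -> linear a.
Proof. by case/(vn_bounded hM). Qed.

Lemma vn0 : M 0.
Proof.
have := vn_linear hM (-1) (vn_id hM) (vn_id hM).
by rewrite scaleN1r addNr.
Qed.

Lemma vnZ (c : R[i]) a : M a -> M (c *: a).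
Proof. by move=> ha; have := vn_linear hM c ha vn0; rewrite addr0. Qed.

Lemma vnD a b : M a -> M b -> M (a + b).
Proof. by move=> ha hb; have := vn_linear hM 1 ha hb; rewrite scale1r. Qed.

Lemma vnB a b : M a -> M b -> M (a - b).
Proof. by move=> ha hb; rewrite -scaleN1r addrC; exact: (vn_linear hM). Qed.

Lemma is_adjoint_adj a : M a -> is_adjoint dot a (adj dot a).
Proof. by move=> /(vn_adjoint hM)[b _ hab]; rewrite (adjE hab). Qed.

Lemma vn_adj a : M a -> M (adj dot a).
Proof. by move=> /(vn_adjoint hM)[b hb hab]; rewrite (adjE hab). Qed.

Lemma adjK a : M a -> adj dot (adj dot a) = a.
Proof. by move=> ha; apply/adjE/is_adjoint_sym/is_adjoint_adj. Qed.

Lemma adj_id : adj dot idfun = idfun.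
Proof. by apply: adjE. Qed.

Lemma adj_comp a b : M a -> M b ->
  adj dot (a \o b) = adj dot b \o adj dot a.
Proof. by move=> ha hb; apply/adjE/is_adjoint_comp; exact: is_adjoint_adj. Qed.

Lemma adj_linear (c : R[i]) a b : M a -> M b ->
  adj dot (c *: a + b) = c^* *: adj dot a + adj dot b.
Proof. by move=> ha hb; apply/adjE/is_adjoint_linear; exact: is_adjoint_adj. Qed.

Lemma adjB a b : M a -> M b -> adj dot (a - b) = adj dot a - adj dot b.
Proof. by move=> ha hb; apply/adjE/is_adjointB; exact: is_adjoint_adj. Qed.

Lemma comp_linear (c : R[i]) a b1 b2 : M a ->
  a \o (c *: b1 + b2) = c *: (a \o b1) + (a \o b2).
Proof. by move=> /vn_lin ha; apply/funext => x; exact: ha. Qed.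

Lemma compB a b1 b2 : M a -> a \o (b1 - b2) = (a \o b1) - (a \o b2).
Proof. by move=> ha; rewrite addrC -scaleN1r comp_linear// scaleN1r addrC. Qed.

Lemma positive_adj_comp a : M a -> positive_op dot (adj dot a \o a).
Proof.
by move=> ha x /=; rewrite (is_adjoint_sym (is_adjoint_adj ha)) dnorm_ge0.
Qed.

Lemma adj_comp_eq0 a : M a -> adj dot a \o a = 0 -> a = 0.
Proof.
move=> ha h; apply/funext => x; apply/eqP; rewrite -(dnorm_eq0 dot).
by rewrite (is_adjoint_adj ha) -[adj dot a (a x)]/((adj dot a \o a) x) h linear0r.
Qed.

Hypothesis hH : hilbert_product dot.

Lemma opnorm_adj a : M a -> opnorm (adj dot a) <= opnorm a.
Proof.
move=> ha; apply: (opnorm_adjoint hH); first exact: (vn_bounded hM).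
  exact/(vn_bounded hM)/vn_adj.
exact: is_adjoint_adj.
Qed.

(** On finitely many pairs of vectors, matrix coefficients of a - p are bounded
    by a constant times the operator norm of a - p, so norm limits are weak
    operator limits. *)
Lemma norm_closure_vn (S : set (H -> H)) : S `<=` M -> norm_closure S `<=` M.
Proof.
move=> SM a [ba ha]; apply: (vn_wot_closed hM ba) => s e e0.
(* The sum bounds each ||x|| ||y||; adding 1 makes it positive. *)
pose k := 1 + \sum_(xy <- s) nrm xy.1 * nrm xy.2.
have s0 (t : seq (H * H)) : 0 <= \sum_(xy <- t) nrm xy.1 * nrm xy.2.
  by apply: sumr_ge0 => xy _; rewrite mulr_ge0 ?nrm_ge0.
have k0 : 0 < k by rewrite ltr_pwDl.
have [p Sp ap] := ha (e / k) (divr_gt0 e0 k0).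
exists p; first exact: SM.
move=> [x y] xys /=.
have bap : bounded_linear (a - p).
  apply: (bounded_linearB ba); exact/(vn_bounded hM)/SM.
set z := dot _ _.
have zE : `|z| = (complex.Re `|z|)%:C%C by rewrite RRe_real// normr_real.
rewrite -ltcR -zE; apply: le_lt_trans (dot_le hH _ _) _; rewrite ltcR.
have xyk : nrm x * nrm y < k.
  rewrite /k (big_rem (x, y))//= addrCA ltrDl.
  by rewrite ltr_pwDl.
apply: (@le_lt_trans _ _ (opnorm (a - p) * (nrm x * nrm y))).
  by rewrite mulrA ler_wpM2r ?nrm_ge0//; exact: (opnorm_ub x bap).
apply: (@le_lt_trans _ _ (e / k * (nrm x * nrm y))).
  by rewrite ler_wpM2r ?mulr_ge0 ?nrm_ge0// ltW.
by rewrite mulrAC ltr_pdivrMr// ltr_pM2l.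
Qed.

End Algebra.

(** * The 2-norm of a trace *)

Section Trace.
Variables (R : realType) (H : completeNormedModType R[i]).
Variables (dot : {dot H for Num.conj}) (M : set (H -> H)).
Hypothesis hM : von_neumann_algebra dot M.
Variable tau : (H -> H) -> R[i].
Hypothesis htau : faithful_normal_tracial_state dot M tau.
Implicit Types (a b : H -> H).
Local Notation "a ^#" := (adj dot a) (at level 2, format "a ^#").
Local Notation l2 := (l2norm dot tau).

Lemma tau0 : tau 0 = 0.
Proof.
have := state_linear htau (-1) (vn_id hM) (vn_id hM).
by rewrite scaleN1r addNr mulN1r addNr.
Qed.

Lemma tauZ (c : R[i]) a : M a -> tau (c *: a) = c * tau a.
Proof.
by move=> ha; have := state_linear htau c ha (vn0 hM); rewrite !addr0 tau0 addr0.
Qed.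

Lemma tauD a b : M a -> M b -> tau (a + b) = tau a + tau b.
Proof.
by move=> ha hb; have := state_linear htau 1 ha hb; rewrite scale1r mul1r.
Qed.

Lemma tauB a b : M a -> M b -> tau (a - b) = tau a - tau b.
Proof.
move=> ha hb; have := state_linear htau (-1) hb ha.
by rewrite scaleN1r mulN1r addrC => ->; rewrite addrC.
Qed.

Lemma tau_ge0 a : M a -> 0 <= tau (a^# \o a).
Proof.
move=> ha; apply: (state_positive htau); last exact: (positive_adj_comp hM).
by apply: (vn_comp hM) => //; exact: (vn_adj hM).
Qed.

Lemma tau_adj_comp_expand (c : R[i]) a b : M a -> M b ->
  tau ((c *: a + b)^# \o (c *: a + b)) =
  c * c^* * tau (a^# \o a) + c * tau (b^# \o a) + c^* * tau (a^# \o b)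
  + tau (b^# \o b).
Proof.
move=> ha hb; have ha' := vn_adj hM ha; have hb' := vn_adj hM hb.
rewrite (adj_linear hM)//.
rewrite (_ : _ \o _ = c^* *: (a^# \o (c *: a + b)) + (b^# \o (c *: a + b)))//.
rewrite !(comp_linear hM)//.
have aa := vn_comp hM ha' ha; have ab := vn_comp hM ha' hb.
have ba := vn_comp hM hb' ha; have bb := vn_comp hM hb' hb.
have la := vn_linear hM c aa ab; have lb := vn_linear hM c ba bb.
rewrite !(state_linear htau)//.
by ring.
Qed.

(** Positive functionals are hermitian: tau((c a + 1)^* (c a + 1)) is real, hence
    so is c tau(a) + c^* tau(a^* ); take c = 1 and c = 'i. *)
Lemma tau_adj a : M a -> tau (a^#) = (tau a)^*.
Proof.
move=> ha; have ha' := vn_adj hM ha.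
have h (c : R[i]) : c * tau a + c^* * tau (a^#) \is Num.real.
  have := tau_ge0 (vn_linear hM c ha (vn_id hM)).
  rewrite tau_adj_comp_expand//; last exact: (vn_id hM).
  rewrite (adj_id dot).
  rewrite -[idfun \o a]/a -[_ \o idfun]/(a^#) -[idfun \o idfun]/idfun.
  rewrite (state_unital htau) -!addrA => /ger0_real.
  rewrite addrA addrA rpredDr ?rpred1// -addrA rpredDl//.
  by apply/ger0_real/mulr_ge0; [exact: mul_conjC_ge0|exact: tau_ge0].
have h1 := CrealP (h 1); have hi := CrealP (h 'i).
move: h1 hi; rewrite !rmorphD !rmorphM /= !conjCK conjC1 !mul1r conjCi.
rewrite !mulNr => h1 hi.
have {}hi : - (tau a)^* + (tau (a^#))^* = tau a - tau (a^#).
  apply: (@mulfI _ 'i); first exact: neq0Ci.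
  by rewrite mulrDr mulrN mulrBr.
apply: (@mulfI _ 2); first by rewrite pnatr_eq0.
have -> : 2 * tau (a^#) = (tau a + tau (a^#)) - (tau a - tau (a^#)) by ring.
by rewrite -h1 -hi; ring.
Qed.

Lemma tauC a b : M a -> M b -> tau (a \o b) = tau (b \o a).
Proof. exact: (state_tracial htau). Qed.

Lemma l2E a : M a -> ((l2 a) ^+ 2)%:C%C = tau (a^# \o a).
Proof.
move=> ha; have t0 := tau_ge0 ha.
have := ger0_real t0 => /RRe_real te.
by rewrite sqr_sqrtr -?ler0c /= te.
Qed.

Lemma l2_ge0 a : 0 <= l2 a.
Proof. exact: sqrtr_ge0. Qed.

Lemma l2_adj a : M a -> l2 (a^#) = l2 a.
Proof.
move=> ha; rewrite /l2norm (adjK hM)// tauC//; exact: (vn_adj hM).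
Qed.

(** The quadratic form of [cauchy_schwarz_of_quadratic] is
    tau((b - l a)^* (b - l a)). *)
Lemma tau_cauchy_schwarz a b : M a -> M b ->
  `|tau (a^# \o b)| <= (l2 a * l2 b)%:C%C.
Proof.
move=> ha hb; have ha' := vn_adj hM ha; have hb' := vn_adj hM hb.
rewrite -ler_sqr ?nnegrE ?normr_ge0//; last first.
  by rewrite ler0c mulr_ge0 ?l2_ge0.
have -> : (l2 a * l2 b)%:C%C ^+ 2 = tau (b^# \o b) * tau (a^# \o a).
  by rewrite -!l2E// -rmorphM -exprMn mulrC rmorphXn.
have hba : tau (b^# \o a) = (tau (a^# \o b))^*.
  by rewrite -(tau_adj (vn_comp hM ha' hb)) (adj_comp hM ha' hb) (adjK hM ha).
apply: cauchy_schwarz_of_quadratic => [||l]; [exact: tau_ge0..|].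
have := tau_ge0 (vn_linear hM (- l) ha hb).
rewrite tau_adj_comp_expand// hba rmorphN /=; congr (0 <= _).
by ring.
Qed.

Lemma tau_le_l2 a b : M a -> M b -> `|tau (a \o b)| <= (l2 a * l2 b)%:C%C.
Proof.
move=> ha hb; have := tau_cauchy_schwarz (vn_adj hM ha) hb.
by rewrite (adjK hM)// l2_adj.
Qed.

Lemma tau_mono a b : M a -> M b -> positive_op dot (b - a) -> tau a <= tau b.
Proof.
move=> ha hb hab; rewrite -subr_ge0 -tauB//.
by apply: (state_positive htau) => //; exact: (vnB hM).
Qed.

Hypothesis hH : hilbert_product dot.

(** The operator inequality a^* a <= ||a||^2. *)
Lemma positive_opnorm a : M a ->
  positive_op dot ((opnorm a ^+ 2)%:C%C *: idfun - (a^# \o a)).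
Proof.
move=> ha x; rewrite /GRing.add /GRing.opp /GRing.scale /=.
rewrite dotDl dotNl dotZl (is_adjoint_sym (is_adjoint_adj hM ha)) !(dotE hH).
rewrite subr_ge0 -rmorphM lecR -exprMn.
rewrite ler_sqr ?nnegrE ?nrm_ge0//; first exact: (opnorm_ub x (vn_bounded hM ha)).
by rewrite mulr_ge0 ?nrm_ge0 ?opnorm_ge0//; exact: (vn_bounded hM).
Qed.

Lemma l2_compl a b : M a -> M b -> l2 (a \o b) <= opnorm a * l2 b.
Proof.
move=> ha hb; have hab := vn_comp hM ha hb.
have oa := opnorm_ge0 (vn_bounded hM ha).
rewrite -ler_sqr ?nnegrE ?l2_ge0 ?mulr_ge0 ?l2_ge0//.
rewrite -lecR l2E// exprMn rmorphM /= l2E//.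
have hbb := vn_comp hM (vn_adj hM hb) hb.
rewrite -tauZ//; apply: tau_mono.
- exact: (vn_comp hM (vn_adj hM hab) hab).
- exact: (vnZ hM).
move=> x; have := positive_opnorm ha (b x).
rewrite (adj_comp hM)// /GRing.add /GRing.opp /GRing.scale /=.
rewrite !dotDl !dotNl !dotZl.
by rewrite !(is_adjoint_sym (is_adjoint_adj hM hb)).
Qed.

(** Traciality turns right multiplication into left multiplication by the
    adjoint. *)
Lemma l2_compr a b : M a -> M b -> l2 (b \o a) <= l2 b * opnorm a.
Proof.
move=> ha hb; have ha' := vn_adj hM ha; have hb' := vn_adj hM hb.
rewrite -l2_adj; last exact: (vn_comp hM).
rewrite (adj_comp hM)// (le_trans (l2_compl ha' hb'))// l2_adj// mulrC.
by rewrite ler_wpM2l ?l2_ge0 ?(opnorm_adj hM hH).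
Qed.

Lemma l2_le_opnorm a : M a -> l2 a <= opnorm a.
Proof.
move=> ha; have := l2_compl ha (vn_id hM).
by rewrite [X in _ <= _ * X]/l2norm adj_id (state_unital htau) sqrtr1 mulr1.
Qed.

(** * The conditional expectation *)

Section Expectation.
Variable B : set (H -> H).
Hypotheses (hB : von_neumann_algebra dot B) (hBM : B `<=` M).
Variable E : (H -> H) -> (H -> H).
Hypothesis hE : trace_cond_expectation dot M B tau E.

Lemma E_in a : M a -> M (E a).
Proof. by move=> /(ce_range hE)/hBM. Qed.

Lemma E_compl b a : B b -> M a -> E (b \o a) = b \o E a.
Proof. by move=> hb ha; exact: (ce_bimodule hE hb ha (vn_id hB)). Qed.

Lemma E_compr a b : B b -> M a -> E (a \o b) = E a \o b.
Proof. by move=> hb ha; exact: (ce_bimodule hE (vn_id hB) ha hb). Qed.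

Lemma EB a b : M a -> M b -> E (a - b) = E a - E b.
Proof.
move=> ha hb; have := ce_linear hE (-1) hb ha.
by rewrite !scaleN1r addrC => ->; rewrite addrC.
Qed.

(** Both sides are tau(E a E b): E is the orthogonal projection onto B for the
    inner product of tau. *)
Lemma tau_E_sym a b : M a -> M b -> tau (a \o E b) = tau (E a \o b).
Proof.
move=> ha hb; have Ea := ce_range hE ha; have Eb := ce_range hE hb.
rewrite -(ce_trace hE (vn_comp hM ha (hBM Eb))) (E_compr Eb ha).
by rewrite -(ce_trace hE (vn_comp hM (hBM Ea) hb)) (E_compl Ea hb).
Qed.

(** The difference d of the two sides lies in B and is orthogonal to itself,
    because tau(d^* E(a^* )) and tau(d^* (E a)^* ) are both tau(d^* a^* ). *)
Lemma E_adj a : M a -> E (a^#) = (E a)^#.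
Proof.
move=> ha; have ha' := vn_adj hM ha.
have BEa := ce_range hE ha; have BEa' := vn_adj hB BEa.
have MEa := hBM BEa; have MEa' := hBM BEa'.
pose d := E (a^#) - (E a)^#.
have Bd : B d by apply: (vnB hB) => //; exact: (ce_range hE).
have Bd' := vn_adj hB Bd; have Md := hBM Bd; have Md' := hBM Bd'.
apply/eqP; rewrite -subr_eq0 -/d; apply/eqP/(adj_comp_eq0 hB Bd).
apply: (state_faithful htau).
- exact: (vn_comp hM).
- exact: (positive_adj_comp hM).
have -> : d^# \o d = (d^# \o E (a^#)) - (d^# \o (E a)^#).
  exact: (compB hM _ _ Md').
rewrite (tauB (vn_comp hM Md' (E_in ha')) (vn_comp hM Md' MEa')).
rewrite -(E_compl Bd' ha') (ce_trace hE (vn_comp hM Md' ha')).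
rewrite -(adj_comp hM MEa Md) (tau_adj (vn_comp hM MEa Md)).
rewrite -(E_compr Bd ha) (ce_trace hE (vn_comp hM ha Md)).
by rewrite -(tau_adj (vn_comp hM ha Md)) (adj_comp hM ha Md) subrr.
Qed.

(** |E a|_2^2 = tau((E a)^* a) <= |E a|_2 |a|_2. *)
Lemma l2_E a : M a -> l2 (E a) <= l2 a.
Proof.
move=> ha; have [->|E0] := eqVneq (l2 (E a)) 0; first exact: l2_ge0.
have Ep : 0 < l2 (E a) by rewrite lt_def E0 l2_ge0.
have BE := ce_range hE ha; have ME := E_in ha; have BE' := vn_adj hB BE.
rewrite -(ler_pM2l Ep) -expr2 -lecR l2E//.
rewrite -(E_compl BE' ha) (ce_trace hE); last exact: (vn_comp hM (hBM BE')).
apply: le_trans (tau_cauchy_schwarz ME ha).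
apply: real_ler_norm; rewrite -(ce_trace hE); last exact: (vn_comp hM (hBM BE')).
by rewrite (E_compl BE' ha); exact/ger0_real/tau_ge0.
Qed.

(** Kadison-Schwarz: applying E to (a - E a)^* (a - E a) >= 0 gives
    (E a)^* (E a) <= E(a^* a), and applying it to a^* a <= ||a||^2 bounds the
    latter by ||a||^2. *)
Lemma opnorm_E a : M a -> opnorm (E a) <= opnorm a.
Proof.
move=> ha; have ha' := vn_adj hM ha; have haa := vn_comp hM ha' ha.
have oa := opnorm_ge0 (vn_bounded hM ha).
have BE := ce_range hE ha; have ME := E_in ha.
have BE' := vn_adj hB BE; have ME' := hBM BE'.
apply: opnorm_le => // x.
rewrite -ler_sqr ?nnegrE ?nrm_ge0 ?mulr_ge0 ?nrm_ge0//.
rewrite -lecR exprMn [leRHS]rmorphM /= -!(dotE hH).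
apply: (@le_trans _ _ (dot (E (a^# \o a) x) x)).
  have Maa := vnB hM ha ME; have Maa' := vn_adj hM Maa.
  have := ce_positive hE (vn_comp hM Maa' Maa) (positive_adj_comp hM Maa) x.
  rewrite (compB hM)// EB; [|exact: (vn_comp hM)..].
  rewrite (E_compr BE Maa') (adjB hM ha ME).
  rewrite (EB ha' ME') E_adj// (ce_id hE BE') subrr.
  rewrite (_ : (a^# - (E a)^#) \o a = (a^# \o a) - ((E a)^# \o a))//.
  rewrite EB; [|exact: (vn_comp hM)..].
  rewrite (E_compl BE' ha) (_ : 0 \o E a = 0)// subr0.
  rewrite /GRing.add /GRing.opp /= !dotDl !dotNl subr_ge0.
  by rewrite (is_adjoint_sym (is_adjoint_adj hM ME)).
have Mk : M ((opnorm a ^+ 2)%:C%C *: idfun) by exact/(vnZ hM)/(vn_id hM).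
have := ce_positive hE (vnB hM Mk haa) (positive_opnorm ha) x.
rewrite EB// (ce_id hE (vnZ hB _ (vn_id hB))).
by rewrite /GRing.add /GRing.opp /GRing.scale /= dotDl dotNl dotZl subr_ge0.
Qed.

End Expectation.
End Trace.
(** * Noncommutative polynomials *)

Section Polynomials.
Variables (R : realType) (H : completeNormedModType R[i]).
Variables (B : set (H -> H)) (X : H -> H).

Lemma poly_alg_word w : B w.1 -> (forall b, b \in w.2 -> B b) ->
  poly_alg B X (word_at X w).
Proof.
move=> w1 w2; exists [:: w]; last by rewrite /poly_at big_seq1.
by move=> v; rewrite inE => /eqP ->.
Qed.

Lemma poly_alg_coef b : B b -> poly_alg B X b.
Proof. by move=> hb; exact: (@poly_alg_word (b, [::])). Qed.

(** Induction on words, the last factor X b of a word being split off, and on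
    sums of words. *)
Lemma poly_alg_ind (Q : (H -> H) -> Prop) :
  B 0 ->
  (forall b, B b -> Q b) ->
  (forall p b, poly_alg B X p -> Q p -> B b -> Q (p \o (X \o b))) ->
  (forall p q, poly_alg B X p -> poly_alg B X q -> Q p -> Q q -> Q (p + q)) ->
  forall p, poly_alg B X p -> Q p.
Proof.
move=> B0 Qb QX QD _ [p hp <-]; elim: p hp => [|[b0 bs] p IHp] hp.
  by rewrite /poly_at big_nil; exact: Qb.
have hp' : poly_in B p by move=> w wp; apply: hp; rewrite inE wp orbT.
have [/= hb0 hbs] := hp (b0, bs) (mem_head _ _).
rewrite /poly_at big_cons; apply: QD; [|by exists p| |exact: IHp].
  exact: poly_alg_word.
elim/last_ind: bs hbs {hp} => [|bs b IHbs] hbs; first exact: Qb.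
have hbs' c : c \in bs -> B c by move=> cbs; apply: hbs; rewrite mem_rcons inE cbs orbT.
have hb : B b by apply: hbs; rewrite mem_rcons mem_head.
rewrite /word_at /= foldl_rcons.
exact: (QX _ _ (@poly_alg_word (b0, bs) hb0 hbs') (IHbs hbs') hb).
Qed.

End Polynomials.

(** * The free Poincare inequality *)

Section FreePoincare.
Variables (R : realType) (H : completeNormedModType R[i]).
Variables (dot : {dot H for Num.conj}).
Hypothesis hH : hilbert_product dot.
Variable M : set (H -> H).
Hypothesis hM : von_neumann_algebra dot M.
Variable tau : (H -> H) -> R[i].
Hypothesis htau : faithful_normal_tracial_state dot M tau.
Variable B : set (H -> H).
Hypotheses (hB : von_neumann_algebra dot B) (hBM : B `<=` M).
Variable E : (H -> H) -> (H -> H).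
Hypothesis hE : trace_cond_expectation dot M B tau E.
Variable X : H -> H.
Hypothesis hXM : M X.
Local Notation "a ^#" := (adj dot a) (at level 2, format "a ^#").
Local Notation l2 := (l2norm dot tau).

Lemma poly_alg_vn : poly_alg B X `<=` M.
Proof.
apply: poly_alg_ind => [|b|p b _ hp hb|p q _ _ hp hq].
- exact: (vn0 hB).
- exact: hBM.
- exact: (vn_comp hM hp (vn_comp hM hXM (hBM hb))).
- exact: (vnD hM).
Qed.

Lemma cstar_poly_alg_vn : cstar_poly_alg B X `<=` M.
Proof. exact: (norm_closure_vn hM hH poly_alg_vn). Qed.

Lemma poly_alg_cstar : poly_alg B X `<=` cstar_poly_alg B X.
Proof.
move=> p hp; split; first exact: (vn_bounded hM (poly_alg_vn hp)).
move=> e e0; exists p => //; rewrite subrr; apply: le_lt_trans e0.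
by apply: opnorm_le => // x; rewrite (_ : (0 : H -> H) x = 0)// nrm0 mul0r.
Qed.

(** The inner product of a (X xi - xi X) b r with s^* xi, for the B-central
    vector xi with <a xi b, c xi d> = tau(d^* E(c^* a) b). The parameter r is
    needed for the induction on words, which moves factors into it. *)
Definition commutator_pairing (s r a b : H -> H) : R[i]^o :=
  tau (s \o a \o (X \o E (b \o r))) - tau (E (s \o a) \o (X \o b \o r)).

Lemma commutator_pairing_bilinear (A : set (H -> H)) s r :
  A `<=` M -> M s -> M r -> bilinear_on A (commutator_pairing s r).
Proof.
move=> AM hs hr; have vc := vn_comp hM; have Ein := E_in hBM hE.
split=> [c a a' b /AM ha /AM ha' /AM hb|c a b b' /AM ha /AM hb /AM hb'].
  rewrite /commutator_pairing (comp_linear hM c a a' hs).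
  have sa := vc _ _ hs ha; have sa' := vc _ _ hs ha'.
  have y := vc _ _ hXM (Ein _ (vc _ _ hb hr)).
  have z := vc _ _ (vc _ _ hXM hb) hr.
  rewrite (ce_linear hE c sa sa').
  set Y := X \o E _; set Z := X \o b \o r.
  have -> : (c *: (s \o a) + (s \o a')) \o Y =
    c *: (s \o a \o Y) + (s \o a' \o Y) by [].
  have -> : (c *: E (s \o a) + E (s \o a')) \o Z =
    c *: (E (s \o a) \o Z) + (E (s \o a') \o Z) by [].
  rewrite (state_linear htau c (vc _ _ sa y) (vc _ _ sa' y)).
  rewrite (state_linear htau c (vc _ _ (Ein _ sa) z) (vc _ _ (Ein _ sa') z)).
  by rewrite scalerBr /GRing.scale /=; ring.
have sa := vc _ _ hs ha; have Esa := Ein _ sa.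
have br := vc _ _ hb hr; have br' := vc _ _ hb' hr.
have y := vc _ _ hXM (Ein _ br); have y' := vc _ _ hXM (Ein _ br').
have z := vc _ _ hXM br; have z' := vc _ _ hXM br'.
rewrite /commutator_pairing.
have -> : (c *: b + b') \o r = c *: (b \o r) + (b' \o r) by [].
have -> : X \o (c *: b + b') \o r = c *: (X \o (b \o r)) + (X \o (b' \o r)).
  by rewrite -(comp_linear hM c _ _ hXM).
rewrite (ce_linear hE c br br') (comp_linear hM c _ _ hXM).
rewrite (comp_linear hM c _ _ sa) (comp_linear hM c _ _ Esa).
rewrite (state_linear htau c (vc _ _ sa y) (vc _ _ sa y')).
rewrite (state_linear htau c (vc _ _ Esa z) (vc _ _ Esa z')).
by rewrite scalerBr /GRing.scale /=; ring.
Qed.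

Variable del : (H -> H) -> seq ((H -> H) * (H -> H)).
Hypothesis hdel : free_difference_quotient B X del.

(** p xi r - xi p r and the image of p under the free difference quotient have
    the same pairing with s^* xi. *)
Let pairs_to (p : H -> H) := forall s r, M s -> M r ->
  tensor_eval (commutator_pairing s r) (del p) =
  tau (s \o p \o E r) - tau (E s \o p \o r).

(** The Leibniz rule p q xi r - xi p q r = (p xi - xi p) q r + p (q xi - xi q) r:
    the middle terms p xi q r cancel by [tau_E_sym]. *)
Let pairs_to_comp p q : poly_alg B X p -> poly_alg B X q ->
  pairs_to p -> pairs_to q -> pairs_to (p \o q).
Proof.
move=> Pp Pq hp hq s r hs hr.
have Mp := poly_alg_vn Pp; have Mq := poly_alg_vn Pq.
have bil := commutator_pairing_bilinear poly_alg_vn hs hr.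
rewrite (fdq_leibniz hdel Pp Pq bil) /tensor_eval big_cat !big_map /=.
have := hp s (q \o r) hs (vn_comp hM Mq hr).
rewrite /tensor_eval /commutator_pairing => ->.
have := hq (s \o p) r (vn_comp hM hs Mp) hr.
rewrite /tensor_eval /commutator_pairing => ->.
have := tau_E_sym hM hB hBM hE (vn_comp hM hs Mp) (vn_comp hM Mq hr).
move=> ->; rewrite addrC addrA.
rewrite -[E (s \o p) \o (q \o r)]/(E (s \o p) \o q \o r) addrNK.
by [].
Qed.

(** Here b xi = xi b, that is, E is B-linear. *)
Let pairs_to_coef b : B b -> pairs_to b.
Proof.
move=> hb s r hs hr; have Mb := hBM hb.
have bil := commutator_pairing_bilinear poly_alg_vn hs hr.
rewrite (fdq_B hdel hb bil) /tensor_eval big_nil.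
rewrite (tau_E_sym hM hB hBM hE (vn_comp hM hs Mb) hr).
by rewrite (E_compr hB hE hb hs) subrr.
Qed.

Let pairs_to_X : pairs_to X.
Proof.
move=> s r hs hr.
have bil := commutator_pairing_bilinear poly_alg_vn hs hr.
by rewrite (fdq_X hdel bil) /tensor_eval big_seq1.
Qed.

Lemma tensor_eval_commutator_pairing p : poly_alg B X p ->
  forall s r, M s -> M r ->
  tensor_eval (commutator_pairing s r) (del p) =
  tau (s \o p \o E r) - tau (E s \o p \o r).
Proof.
move: p; apply: poly_alg_ind => [|b|p b Pp hp hb|p q Pp Pq hp hq].
- exact: (vn0 hB).
- exact: pairs_to_coef.
- have PXc c : B c -> poly_alg B X (X \o c).
    move=> hc; apply: (@poly_alg_word _ _ _ _ (idfun, [:: c])).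
      exact: (vn_id hB).
    by move=> b' /=; rewrite inE => /eqP ->.
  have PX : poly_alg B X X := PXc idfun (vn_id hB).
  have PXb := PXc b hb.
  apply: (pairs_to_comp Pp PXb hp).
  exact: (pairs_to_comp PX (poly_alg_coef X hb) pairs_to_X (pairs_to_coef hb)).
move=> s r hs hr.
have bil := commutator_pairing_bilinear poly_alg_vn hs hr.
have := fdq_linear hdel 1 Pp Pq bil; rewrite scale1r => ->.
have Mp := poly_alg_vn Pp; have Mq := poly_alg_vn Pq.
have Es := E_in hBM hE hs; have Er := E_in hBM hE hr.
have vc := vn_comp hM.
rewrite /tensor_eval big_cat big_map /=.
have -> : \sum_(t <- del p) commutator_pairing s r (1 *: t.1) t.2 =
    tensor_eval (commutator_pairing s r) (del p).
  by apply: eq_bigr => t _; rewrite scale1r.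
rewrite hp// -/(tensor_eval _ _) hq//.
have := comp_linear hM 1 p q hs; rewrite !scale1r => ->.
have := comp_linear hM 1 p q Es; rewrite !scale1r => ->.
rewrite -[((s \o p) + (s \o q)) \o E r]/((s \o p \o E r) + (s \o q \o E r)).
rewrite -[((E s \o p) + (E s \o q)) \o r]/((E s \o p \o r) + (E s \o q \o r)).
rewrite (tauD htau (vc _ _ (vc _ _ hs Mp) Er) (vc _ _ (vc _ _ hs Mq) Er)).
rewrite (tauD htau (vc _ _ (vc _ _ Es Mp) hr) (vc _ _ (vc _ _ Es Mq) hr)).
by ring.
Qed.

(** Cauchy-Schwarz with the factorizations (s^* a)(X E(b)) and
    (E(s^* a))(X b). *)
Lemma commutator_pairing_le s a b : M s -> M a -> M b ->
  `|commutator_pairing (s^#) idfun a b : R[i]| <=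
  (2 * l2 s * l2 X * (opnorm a * opnorm b))%:C%C.
Proof.
move=> hs ha hb; have vc := vn_comp hM; have Ein := E_in hBM hE.
have hs' := vn_adj hM hs; have sa := vc _ _ hs' ha.
have oa := opnorm_ge0 (vn_bounded hM ha).
have ob := opnorm_ge0 (vn_bounded hM hb).
have l2sa : l2 (s^# \o a) <= l2 s * opnorm a.
  by rewrite -(l2_adj hM htau hs); exact: (l2_compr hM htau hH).
have l2s := l2_ge0 dot tau s; have l2X := l2_ge0 dot tau X.
have bound (u v : H -> H) : M u -> M v -> l2 u <= l2 s * opnorm a ->
    l2 v <= l2 X * opnorm b ->
    `|tau (u \o v)| <= (l2 s * l2 X * (opnorm a * opnorm b))%:C%C.
  move=> hu hv lu lv; apply: le_trans (tau_le_l2 hM htau hu hv) _.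
  by rewrite lecR mulrACA ler_pM// l2_ge0.
have -> : (2 * l2 s * l2 X * (opnorm a * opnorm b))%:C%C =
  (l2 s * l2 X * (opnorm a * opnorm b))%:C%C +
  (l2 s * l2 X * (opnorm a * opnorm b))%:C%C :> R[i].
  by rewrite -rmorphD /=; congr (_%:C%C); ring.
rewrite /commutator_pairing; apply: le_trans (ler_normB _ _) _; apply: lerD.
  apply: bound => //; first exact: (vc _ _ hXM (Ein _ hb)).
  apply: le_trans (l2_compr hM htau hH (Ein _ hb) hXM) _.
  by rewrite ler_wpM2l// (opnorm_E hM htau hH hB hBM hE).
apply: bound => //; [exact: (Ein _ sa)|exact: (vc _ _ hXM hb)| |].
  exact: le_trans (l2_E hM htau hB hBM hE sa) l2sa.
exact: (l2_compr hM htau hH hb hXM).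
Qed.

Local Notation A := (cstar_poly_alg B X).

(** With r = 1 the pairing is tau(s^* (p - E p)). Being a bilinear form on
    C^*(B<X>), it takes the same value on all tensors that represent the free
    difference quotient of p, in particular on nearly optimal ones. *)
Lemma poincare_polynomial s p : M s -> poly_alg B X p ->
  `|tau (s^# \o (p - E p))| <= (2 * l2 s * l2 X * projective_norm A (del p))%:C%C.
Proof.
move=> hs Pp; have hs' := vn_adj hM hs; have Mp := poly_alg_vn Pp.
have Bi := vn_id hB; have Mi := vn_id hM.
have -> : tau (s^# \o (p - E p)) =
    tensor_eval (commutator_pairing (s^#) idfun) (del p).
  rewrite (tensor_eval_commutator_pairing Pp hs' Mi) (ce_id hE Bi).
  rewrite -[_ \o p \o idfun]/(s^# \o p) -[_ \o p \o idfun]/(E (s^#) \o p).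
  rewrite -(tau_E_sym hM hB hBM hE hs' Mp) (compB hM _ _ hs').
  have Ep := E_in hBM hE Mp.
  by rewrite (tauB htau (vn_comp hM hs' Mp) (vn_comp hM hs' Ep)).
set x : R[i] := tensor_eval _ _; set k := 2 * _ * _.
have k0 : 0 <= k by rewrite !mulr_ge0 ?l2_ge0.
have xE : `|x| = (complex.Re `|x|)%:C%C by rewrite RRe_real// normr_real.
rewrite xE lecR.
have bound v : tensor_in A v -> tensor_eq A v (del p) ->
    complex.Re `|x| <= k * \sum_(t <- v) opnorm t.1 * opnorm t.2.
  move=> Av vp; rewrite -lecR -xE /x.
  rewrite -(vp _ _ (commutator_pairing_bilinear cstar_poly_alg_vn hs' Mi)).
  rewrite mulr_sumr rmorph_sum /= /tensor_eval.
  apply: le_trans (ler_norm_sum _ _ _) _; rewrite !big_seq.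
  apply: ler_sum => t /Av[/cstar_poly_alg_vn t1 /cstar_poly_alg_vn t2].
  exact: commutator_pairing_le.
have Adel : tensor_in A (del p).
  by move=> t /(fdq_range hdel Pp)[t1 t2]; split; exact: poly_alg_cstar.
(* Dividing by k moves it across the infimum, so k = 0 is separate. *)
have [kz|kn] := eqVneq k 0.
  by have := bound _ Adel (fun _ _ _ => erefl); rewrite kz !mul0r.
have kp : 0 < k by rewrite lt_def kn.
rewrite -ler_pdivrMl//; apply: lb_le_inf.
  by exists (\sum_(t <- del p) opnorm t.1 * opnorm t.2), (del p).
by move=> _ [v [Av vp] <-]; rewrite ler_pdivrMl//; exact: bound.
Qed.

(** With d = f - E f and g = p - f, write d = (p - E p) - (g - E g) in one factor
    of tau(d^* d): the first part is controlled by [poincare_polynomial], the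
    second by 2 |d|_2 ||g||. Dividing by |d|_2 and letting e tend to 0 gives
    the bound. *)
Lemma poincare_of_approx (f : H -> H) (c : R) : M f -> 0 <= c ->
  (forall e, 0 < e -> exists p, [/\ poly_alg B X p, opnorm (p - f) <= e &
     projective_norm A (del p) <= c + e]) ->
  l2 (f - E f) <= 2 * l2 X * c.
Proof.
move=> Mf c0 happ; pose d := f - E f.
have Ef := E_in hBM hE Mf; have Md : M d := vnB hM Mf Ef.
have Md' := vn_adj hM Md.
have d0 : 0 <= l2 d := l2_ge0 _ _ _; have X0 : 0 <= l2 X := l2_ge0 _ _ _.
rewrite -/d; have [->|dn] := eqVneq (l2 d) 0; first by rewrite !mulr_ge0.
have dp : 0 < l2 d by rewrite lt_def dn.
have main e : 0 < e -> l2 d <= 2 * l2 X * (c + e) + 2 * e.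
  move=> e0; have [p [Pp pf pc]] := happ e e0.
  have Mp := poly_alg_vn Pp; have Ep := E_in hBM hE Mp.
  pose g := p - f; have Mg : M g := vnB hM Mp Mf; have Eg := E_in hBM hE Mg.
  have dE : d = (p - E p) - (g - E g).
    by rewrite /g (EB hE Mp Mf) opprB addrA subrKA opprB addrC subrKA.
  have tE : tau (d^# \o d) = tau (d^# \o (p - E p)) -
      (tau (d^# \o g) - tau (d^# \o E g)).
    have -> : d^# \o d = (d^# \o (p - E p)) - ((d^# \o g) - (d^# \o E g)).
      by rewrite -(compB hM g (E g) Md') -(compB hM _ _ Md') -dE.
    have Mg' := vn_comp hM Md' Mg; have Eg' := vn_comp hM Md' Eg.
    rewrite (tauB htau _ (vnB hM Mg' Eg')) ?(tauB htau Mg' Eg')//.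
    exact: (vn_comp hM Md' (vnB hM Mp Ep)).
  have lg : l2 g <= e := le_trans (l2_le_opnorm hM htau hH Mg) pf.
  have lEg : l2 (E g) <= e := le_trans (l2_E hM htau hB hBM hE Mg) lg.
  have b u : M u -> l2 u <= e -> `|tau (d^# \o u)| <= (l2 d * e)%:C%C.
    move=> hu lu; apply: le_trans (tau_cauchy_schwarz hM htau Md hu) _.
    by rewrite lecR ler_wpM2l.
  rewrite -(ler_pM2l dp) -expr2 -lecR (l2E hM htau Md) tE.
  apply: (@le_trans _ _ `|tau (d^# \o d)|).
    by rewrite -tE ger0_norm//; exact: (tau_ge0 hM htau).
  rewrite tE; apply: le_trans (ler_normB _ _) _.
  rewrite [leRHS](_ : _ = (2 * l2 d * l2 X * (c + e))%:C%C +
    ((l2 d * e)%:C%C + (l2 d * e)%:C%C)); last first.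
    by rewrite -!rmorphD /=; congr (_%:C%C); ring.
  apply: lerD.
    apply: le_trans (poincare_polynomial Md Pp) _.
    by rewrite lecR ler_wpM2l// !mulr_ge0.
  by apply: le_trans (ler_normB _ _) _; apply: lerD; exact: b.
apply/ler_addgt0Pr => e e0.
have k0 : 0 < 2 * l2 X + 2 by rewrite ltr_wpDl// mulr_ge0.
have := main (e / (2 * l2 X + 2)) (divr_gt0 e0 k0).
move=> /le_trans; apply; rewrite mulrDr -addrA lerD2l -mulrDl.
by rewrite mulrC divfK// gt_eqF.
Qed.

Variables (P : completeNormedModType R[i]) (tenP : (H -> H) -> (H -> H) -> P).
Hypothesis hP : projective_tensor A tenP.

(** A common form of the two descriptions of the domain of the closure: graph
    limits, and the completion in the graph norm. *)
Lemma poincare_of_tensor_approx (f : H -> H) (z : P) : M f ->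
  (forall e, 0 < e -> exists p, [/\ poly_alg B X p, opnorm (p - f) <= e &
     nrm (tensor_eval tenP (del p) - z) <= e]) ->
  l2 (f - E f) <= 2 * l2 X * nrm z.
Proof.
move=> Mf happ; apply: poincare_of_approx => // [|e /happ[p [Pp pf pz]]].
  exact: nrm_ge0.
exists p; split=> //; rewrite -(pt_norm hP); last first.
  by move=> t /(fdq_range hdel Pp)[t1 t2]; split; exact: poly_alg_cstar.
rewrite -[X in nrm X](subrK z) addrC; apply: le_trans (nrmD _ _) _.
by rewrite lerD2l.
Qed.

End FreePoincare.

Theorem theorem2p3 (R : realType)
  (H : completeNormedModType R[i]) (dotH : {dot H for Num.conj})
  (hH : hilbert_product dotH)
  (M : set (H -> H)) (hM : von_neumann_algebra dotH M)
  (tau : (H -> H) -> R[i]) (htau : faithful_normal_tracial_state dotH M tau)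
  (B : set (H -> H)) (hB : von_neumann_algebra dotH B) (hBM : B `<=` M)
  (E : (H -> H) -> (H -> H)) (hE : trace_cond_expectation dotH M B tau E)
  (X : H -> H) (hXM : M X) (hXsa : is_adjoint dotH X X)
  (hXfree : algebraically_free B X)
  (del : (H -> H) -> seq ((H -> H) * (H -> H)))
  (hdel : free_difference_quotient B X del)
  (K : completeNormedModType R[i]) (dotK : {dot K for Num.conj})
  (hK : hilbert_product dotK)
  (tenK : H -> H -> K) (htenK : hilbert_tensor dotH dotK tenK)
  (hclos : closable_in_operator_norm tenK B X del)
  (P : completeNormedModType R[i]) (tenP : (H -> H) -> (H -> H) -> P)
  (hP : projective_tensor (cstar_poly_alg B X) tenP) :
  (forall (f : H -> H) (z : P), closure_graph tenP B X del f z ->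
     l2norm dotH tau (f - E f) <= 2 * l2norm dotH tau X * nrm z) /\
  (forall (N : completeNormedModType R[i]) (j : (H -> H) -> N)
     (iota : N -> H -> H) (delt : N -> P),
     B1_completion B X del j -> B1_iota B X j iota ->
     B1_derivation tenP B X del j delt ->
     forall f : N,
       l2norm dotH tau (iota f - E (iota f)) <=
         2 * l2norm dotH tau X * nrm (delt f)).
Proof.
split=> [f z [/(cstar_poly_alg_vn hH hM hB hBM hXM) Mf [p [Pp pf pz]]]|].
  apply: (poincare_of_tensor_approx hH hM htau hB hBM hE hXM hdel hP Mf).
  move=> e e0.
  have small (u : nat -> R) : u n @[n --> \oo] --> (0 : R) ->
      \forall n \near \oo, u n <= e.
    move=> /cvgrPdist_le/(_ e e0); apply: filterS => n.
    by rewrite sub0r normrN; exact: le_trans (ler_norm _).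
  have [n [pn zn]] := filter_ex (filterI (small _ pf) (small _ pz)).
  by exists (p n).
move=> N j iota delt hj hi [[ldelt [k hk]] deltj] f.
have Mf := cstar_poly_alg_vn hH hM hB hBM hXM (iota_range hi f).
apply: (poincare_of_tensor_approx hH hM htau hB hBM hE hXM hdel hP Mf).
move=> e e0; have [l hl] := iota_bounded hi.
(* One constant dominating the norms of both iota and delt. *)
have c0 : 0 < `|k| + `|l| + 1 by rewrite ltr_wpDl.
have [p Pp fp] := b1_dense hj f (divr_gt0 e0 c0).
have small (m : R) : `|m| <= `|k| + `|l| + 1 -> m * nrm (f - j p) <= e.
  move=> hm; apply: (@le_trans _ _ ((`|k| + `|l| + 1) * nrm (f - j p))).
    by rewrite ler_wpM2r ?nrm_ge0// (le_trans (ler_norm _)).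
  by rewrite mulrC -ler_pdivlMr// ltW.
exists p; split=> //.
  have -> : p - iota f = iota (j p - f).
    have := iota_linear hi (-1) f (j p).
    by rewrite (iota_extends hi Pp) !scaleN1r (addrC (- f)) => ->; rewrite addrC.
  apply: le_trans (hl _) _; rewrite nrmB small//.
  by rewrite addrAC lerDr addr_ge0.
have -> : tensor_eval tenP (del p) - delt f = delt (j p - f).
  have := ldelt (-1) f (j p).
  by rewrite deltj// !scaleN1r (addrC (- f)) => ->; rewrite addrC.
apply: le_trans (hk _) _; rewrite nrmB small//.
by rewrite -addrA lerDl addr_ge0.
Qed.
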